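(* There is a function $f:\mathbb{N}\to\mathbb{N}$ such that for every tournament $T$ and every BST order $<$ of $T$, \[ \mathrm{tww}(T,<)\le f(\mathrm{tww}(T)). \]
   Context: All structures are finite. A tournament is a loopless directed graph with exactly one of $u\to v$, $v\to u$ for every pair of distinct vertices. $(T,<)$ is the structure with domain $V(T)$ and two binary relations: the edge relation of $T$ and the strict total order $<$. BST orders. A binary search tree (BST) of a tournament $T$ is a rooted ordered binary tree $S$ (each node has a left and a right child, either of which may be missing) whose nodes are exactly the vertices of $T$, such that for every node $x$, the left child of $x$ (if any) and all its descendants are in-neighbours of $x$ in $T$, and the right child of $x$ (if any) and all its descendants are out-neighbours of $x$. The associated BST order $<_S$ is the in-order traversal order: each $x$ is placed after all nodes of its left subtree and before all nodes of its right subtree. Twin-width. In a binary relational structure $S$, disjoint subsets $X,Y$ of the domain are homogeneous if for each relation $R$: either $xRy$ for all $x\in X,y\in Y$ or for none, and likewise for $yRx$. A contraction sequence for $S$ (with $n$ elements) is a sequence $\mathcal{P}_n,\dots,\mathcal{P}_1$ of partitions of the domain, where $\mathcal{P}_n$ is the partition into singletons, $\mathcal{P}_1$ has one part, and $\mathcal{P}_i$ is obtained from $\mathcal{P}_{i+1}$ by merging two parts. Its width is the maximum over all $i$ and $X\in\mathcal{P}_i$ of the number of parts $Y\in\mathcal{P}_i\setminus\{X\}$ not homogeneous to $X$. The twin-width $\mathrm{tww}(S)$ is the minimum width of a contraction sequence. *)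

(* Defs.v *)
From mathcomp Require Import all_boot.

Set Implicit Arguments.
Unset Strict Implicit.
Unset Printing Implicit Defensive.

Definition tournament (T : finType) (e : rel T) : Prop :=
  irreflexive e /\ (forall x y : T, x != y -> e x y (+) e y x).

Section TwinWidth.

(* A binary relational structure is a finite domain T with a list of relations. *)
Variables (T : finType) (Rs : seq (rel T)).

Definition uniform (R : rel T) (X Y : {set T}) : bool :=
  [forall x in X, forall y in Y, R x y]
  || [forall x in X, forall y in Y, ~~ R x y].

Definition homogeneous (X Y : {set T}) : bool :=
  all (fun R => uniform R X Y && uniform R Y X) Rs.

Definition red_degree (P : {set {set T}}) (X : {set T}) : nat :=
  #|[set Y in P :\ X | ~~ homogeneous X Y]|.

Definition merges (P Q : {set {set T}}) : bool :=
  [exists X in P, exists Y in P,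
     (X != Y) && (Q == (X :|: Y) |: (P :\: [set X; Y]))].

(* The entry of index i is the partition P_(n - i) into n - i parts, n = #|T|. *)
Definition contraction_sequence (s : #|T|.-tuple {set {set T}}) : bool :=
  [&& all (fun P => partition P [set: T]) s,
      head set0 s == [set [set x] | x : T],
      last set0 s == [set [set: T]]
    & sorted merges s].

Definition width (s : seq {set {set T}}) : nat :=
  \max_(P <- s) \max_(X in P) red_degree P X.

(* The default #|T| bounds every width, so this is the true minimum as soon
   as T is nonempty: see tww_le and tww_attained. It is 0 when T is empty. *)
Definition tww : nat :=
  \big[minn/#|T|]_(s : #|T|.-tuple {set {set T}} | contraction_sequence s)
    width s.

Lemma tww_le (s : #|T|.-tuple {set {set T}}) :
  contraction_sequence s -> tww <= width s.
Proof.
move=> cs; rewrite /tww; have := mem_index_enum s.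
elim: (index_enum _) => // t r IHr; rewrite inE big_cons => /orP[/eqP<-|sr].
  by rewrite cs geq_minl.
by case: ifP => _; rewrite ?geq_min IHr ?orbT.
Qed.

Lemma card_partition_le (P : {set {set T}}) :
  partition P [set: T] -> #|P| <= #|T|.
Proof.
move=> pP; rewrite -cardsT (card_partition pP) -sum1_card.
apply: leq_sum => X XP; rewrite card_gt0.
by case/and3P: pP => _ _; apply: contraNneq => <-.
Qed.

Lemma width_le (s : #|T|.-tuple {set {set T}}) :
  contraction_sequence s -> width s <= #|T|.
Proof.
case/and4P => /allP ps _ _ _; rewrite /width big_seq.
elim/big_ind: _ => // [m n mT nT|P /ps /card_partition_le PT].
  by rewrite geq_max mT.
apply/bigmax_leqP => X _; apply: leq_trans PT; apply: subset_leq_card.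
by apply/subsetP => Y; rewrite !inE => /andP[/andP[]].
Qed.

Lemma merges_partition (P : {set {set T}}) :
  partition P [set: T] -> 1 < #|P| ->
  exists Q, [/\ merges P Q, partition Q [set: T] & #|Q| = #|P|.-1].
Proof.
move=> pP /card_gt1P[X [Y [XP YP XY]]].
have [cP tP n0P] := and3P pP.
have dXY : forall Z W, Z \in P -> W \in P -> Z != W -> [disjoint Z & W].
  by move=> Z W ZP WP; apply: (trivIsetP tP).
exists ((X :|: Y) |: (P :\: [set X; Y])).
have X0 : X != set0 by apply: contraNneq n0P => <-.
have dU Z : Z \in P :\: [set X; Y] -> [disjoint X :|: Y & Z].
  rewrite !inE negb_or => /andP[/andP[ZX ZY] ZP].
  by rewrite -setI_eq0 setIUl setU_eq0 !setI_eq0 !dXY // eq_sym.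
have nU : X :|: Y \notin P :\: [set X; Y].
  apply/negP => /dU; rewrite -setI_eq0 setIid => /eqP E.
  by move: X0; rewrite -subset0 -E subsetUl.
split.
- by apply/existsP; exists X; rewrite XP; apply/existsP; exists Y;
    rewrite YP XY eqxx.
- apply/and3P; split.
  + rewrite eqEsubset subsetT; apply/subsetP => z zT.
    rewrite -(eqP cP) in zT; case/bigcupP: zT => Z ZP zZ.
    case: (boolP (Z \in [set X; Y])) => ZXY.
      apply/bigcupP; exists (X :|: Y); rewrite ?setU11 //.
      by move: ZXY zZ; rewrite !inE => /orP[]/eqP-> ->; rewrite ?orbT.
    by apply/bigcupP; exists Z => //; rewrite inE in_setD ZXY ZP orbT.
  + apply/trivIsetP => Z W; rewrite !(in_setU1, in_setD1).
    case/orP => [/eqP->|ZP]; case/orP => [/eqP->|WP].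
    * by rewrite eqxx.
    * by move=> _; apply: dU.
    * by move=> _; rewrite disjoint_sym; apply: dU.
    * by apply: dXY; [move: ZP|move: WP]; rewrite in_setD => /andP[].
  + rewrite in_setU1 in_setD negb_or (negPf n0P) andbF andbT.
    rewrite eq_sym; apply: contraNneq X0 => E.
    by rewrite -subset0 -E subsetUl.
- rewrite cardsU1 nU cardsD.
  have -> : P :&: [set X; Y] = [set X; Y].
    by apply/setIidPr/subsetP => Z; rewrite !inE => /orP[]/eqP->.
  rewrite cards2 XY /=.
  have : 1 < #|P| by apply/card_gt1P; exists X, Y.
  by case: #|P| => [|[|n]] //= _; rewrite subSS subSS subn0.
Qed.

Lemma contraction_sequence_from n (P : {set {set T}}) :
  partition P [set: T] -> #|P| = n.+1 ->
  exists s, [/\ size s = n, all (fun Q => partition Q [set: T]) s,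
    last P s = [set [set: T]] & path merges P s].
Proof.
elim: n P => [|n IHn] P pP cP.
  exists [::]; split=> //=; have /cards1P[X EP] := introT eqP cP.
  by case/and3P: pP => /eqP <- _ _; rewrite EP /cover big_set1.
have [|Q [PQ pQ cQ]] := merges_partition pP; first by rewrite cP.
have [|s [ss ps ls ms]] := IHn Q pQ; first by rewrite cQ cP.
by exists (Q :: s); split; rewrite /= ?ss ?pQ ?PQ.
Qed.

Lemma tww_attained :
  0 < #|T| -> exists2 s, contraction_sequence s & width s = tww.
Proof.
move=> T0; pose P := [set [set x] | x : T].
have cP : #|P| = #|T| by rewrite card_imset //; apply: set1_inj.
have pP : partition P [set: T].
  apply/and3P; split.
  - rewrite eqEsubset subsetT; apply/subsetP => x _; apply/bigcupP.
    by exists [set x]; rewrite ?set11 ?imset_f.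
  - apply/trivIsetP => _ _ /imsetP[x _ ->] /imsetP[y _ ->] xy.
    by rewrite disjoints1 inE; apply: contraNneq xy => ->.
  - by apply/imsetP => -[x _ /esym/eqP]; rewrite -subset0 sub1set inE.
have [|s [ss ps ls ms]] := @contraction_sequence_from #|T|.-1 P pP.
  by rewrite cP prednK.
have sz : size (P :: s) == #|T| by rewrite /= ss prednK.
have cs : contraction_sequence (Tuple sz).
  by apply/and4P; split; rewrite //= ?pP // ls.
case: (arg_minnP (fun s : #|T|.-tuple _ => width s) cs) => t ct t_min.
exists t => //; apply/eqP; rewrite eqn_leq tww_le // andbT /tww.
apply: (big_ind (fun m => width t <= m)) => //; first exact: width_le.
by move=> m n tm tn; rewrite leq_min tm.
Qed.

End TwinWidth.

Inductive bintree (T : Type) : Type :=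
| Empty
| Node (l : bintree T) (x : T) (r : bintree T).

Arguments Empty {T}.

Fixpoint inorder (T : Type) (S : bintree T) : seq T :=
  if S is Node l x r then inorder l ++ x :: inorder r else [::].

Fixpoint search_tree (T : Type) (e : rel T) (S : bintree T) : bool :=
  if S is Node l x r then
    [&& all (fun y => e y x) (inorder l), all (fun y => e x y) (inorder r),
        search_tree e l & search_tree e r]
  else true.

Definition bst (T : finType) (e : rel T) (S : bintree T) : Prop :=
  perm_eq (inorder S) (enum T) /\ search_tree e S.

Definition bst_order (T : finType) (S : bintree T) : rel T :=
  fun x y => index x (inorder S) < index y (inorder S).

(* Main.v *)
(* Let P be a partition in a contraction sequence of T of width d; call two
   parts adjacent if they are equal or not homogeneous.  Cut every part X into
   runs, two vertices of X being in the same run when every vertex strictly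
   between them in the BST order lies in a part at distance at most 3 from X.
   Two runs from parts at distance more than 3 are homogeneous for the order as
   well as for T.  Merging parts of P only coarsens the runs, so it is enough to
   bound the number of runs in X by a function of d; single merges then lead
   from one run partition to the next.

   Suppose x_1 < z_1 < x_2 < ... < x_n with x_i in X and z_i far from X.  Up to
   passing to a subsequence, every vertex w at distance at most 2 from X has the
   same orientation towards all z_i, so all z_i below w in the tree lie on one
   side of w.  Descend in the tree: a node that separates the remaining x_i is
   adjacent to X, and since it cannot separate the remaining z_i, it only cuts
   off the first or the last x_i.  If two nodes w, w' of one part both cut off
   a first element x_i, resp. x_j with i < j, some node u between them separates
   z_i from x_j, and then w -> u -> w' makes the part of u adjacent to that of
   w.  So u is at distance at most 2 from X, yet z_i -> u -> z_j or z_i = u: a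
   contradiction.  Hence n is bounded in terms of the number of parts adjacent
   to X. *)
Require Import Defs.
From mathcomp Require Import all_boot.
From mathcomp Require Import zify.

Set Implicit Arguments.
Unset Strict Implicit.
Unset Printing Implicit Defensive.

(** * Vertices of a part separated by far vertices *)

Section SeparatedClass.

Variables (T C : finType) (c : T -> C) (near : rel T) (x0 : T) (X Z : {set T}).

Section Escape.

Variables (e lt : rel T).

(* The vertices V of the current subtree lie to the right of a node w of the
   part q, adjacent to the part of x0.  The far vertex z following w is either
   still in the subtree, before every remaining vertex of X, or was split off
   by a node u below w.  The symmetric situation, w to the right of the subtree,
   is obtained by flipping both e and lt. *)
Definition escape (V : seq T) (q : C) : Prop :=
  exists w z, [/\ c w = q, near x0 w, z \in Z, {in V, forall y, e w y} &
    (z \in V /\ {in V, forall x, x \in X -> lt z x}) \/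
    (exists u, [/\ e w u, {in V, forall y, e u y} & z = u \/ e z u])].

(** Descending to the right of a node [v]: if the far vertex [z] is left behind, it is [v] or lies
    to the left of [v], and [v] takes the role of the splitting node [u]. *)
Lemma escape_right (V V' : seq T) v q :
    {subset V' <= V} -> v \in V -> {in V', forall y, e v y} ->
    {in V, forall z, [\/ z \in V', z = v | e z v]} ->
  escape V q -> escape V' q.
Proof.
move=> sV vV ev zV [w [z [cw nw zZ ewV zu]]]; exists w, z; split=> //.
  by move=> y /sV /ewV.
case: zu => [[zV1 ltz]|[u [ewu euV zu]]]; last first.
  by right; exists u; split=> // y /sV /euV.
case: (zV z zV1) => [zV'|zv|ezv].
- by left; split=> // x /sV /ltz.
- by right; exists v; split=> //; [apply: ewV|left].
- by right; exists v; split=> //; [apply: ewV|right].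
Qed.

(** Descending to the left: a far vertex that is still in the subtree precedes the surviving vertex
    [x] of [X], so it is kept. *)
Lemma escape_left (V V' : seq T) x q :
    {subset V' <= V} -> x \in V' -> x \in X ->
    {in V, forall z, lt z x -> z \in V'} ->
  escape V q -> escape V' q.
Proof.
move=> sV xV' xX zV [w [z [cw nw zZ ewV zu]]]; exists w, z; split=> //.
  by move=> y /sV /ewV.
case: zu => [[zV1 ltz]|[u [ewu euV zu]]]; last first.
  by right; exists u; split=> // y /sV /euV.
left; split; last by move=> y /sV /ltz.
by apply: zV => //; apply: ltz => //; apply: sV.
Qed.

Hypothesis e_asym : forall x y, e x y -> ~~ e y x.
Hypothesis e_far : forall a b v, ~~ near a v -> c a = c b ->
  (e a v = e b v) * (e v a = e v b).
Hypothesis Z_type : forall v w z z', near x0 v -> near v w ->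
  z \in Z -> z' \in Z -> (e w z = e w z') * (e z w = e z' w).
Hypothesis Z_far : forall v w, near x0 v -> near v w -> w \notin Z.

(** This is why one part cannot cut off twice on the same side. If [z'] is still in [V], it precedes
    [x], so [z' -> w] while [w -> z], against [Z_type]. Otherwise [v -> u -> w] with [v] and [w] in
    one part, so [u] is near [w]; then [u] is not in [Z], and [z' -> u -> z] contradicts
    [Z_type]. *)
Lemma escape_fresh (V : seq T) w z x :
    near x0 w -> near w w -> w \in V -> z \in V -> z \in Z -> e w z ->
    x \in V -> x \in X -> {in V, forall y, lt y x -> e y w} ->
  ~ escape V (c w).
Proof.
move=> nw nww wV zV zZ ewz xV xX yw [v [z' [cv nv z'Z evV]]].
case=> [[z'V ltz']|[u [evu euV z'u]]].
  have := yw z' z'V (ltz' x xV xX).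
  by rewrite (Z_type nw nww z'Z zZ); apply/negP/e_asym.
have nwu : near w u.
  apply/negPn/negP => /e_far /(_ (esym cv))[]; rewrite evu => ewu _.
  by have := e_asym (euV w wV); rewrite ewu.
case: z'u => [z'u|ez'u]; first by have := Z_far nw nwu; rewrite -z'u z'Z.
have := e_asym ez'u; rewrite (Z_type nw nwu z'Z zZ) euV //.
Qed.

End Escape.

Definition flip (r : rel T) : rel T := fun x y => r y x.

Lemma pairwise_count2 (r : rel T) (s : seq T) (p : pred T) :
  pairwise r s -> 1 < count p s ->
  exists x y, [/\ x \in s, y \in s, p x, p y & r x y].
Proof.
elim: s => //= a s IHs /andP[ra ps]; case pa: (p a) => /=.
  rewrite add1n ltnS -has_count => /hasP[y ys py].
  by exists a, y; rewrite !inE eqxx ys pa py (allP ra) ?orbT.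
rewrite add0n => /(IHs ps)[x [y [xs ys px py rxy]]].
by exists x, y; rewrite !inE xs ys !orbT.
Qed.

Lemma pairwise_min (r : rel T) (s : seq T) (p : pred T) :
  pairwise r s -> has p s ->
  exists2 x, x \in s /\ p x & {in s, forall y, p y -> y = x \/ r x y}.
Proof.
elim: s => //= a s IHs /andP[ra ps]; have [pa _|/negPf pa /= hs] := boolP (p a).
  exists a; first by rewrite inE eqxx.
  by move=> y /predU1P[->|/(allP ra) ray] _; [left|right].
have [x [xs px] xmin] := IHs ps hs; exists x; first by rewrite inE xs orbT.
by move=> y /predU1P[->|ys]; [rewrite pa|apply: xmin].
Qed.

Lemma pairwise_max (r : rel T) (s : seq T) (p : pred T) :
  pairwise r s -> has p s ->
  exists2 x, x \in s /\ p x & {in s, forall y, p y -> y = x \/ r y x}.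
Proof.
elim/last_ind: s => // s a IHs; rewrite pairwise_rcons has_rcons.
case/andP=> /allP ra ps; have [pa _|/negPf pa /= hs] := boolP (p a).
  exists a; first by rewrite mem_rcons inE eqxx.
  by move=> y; rewrite mem_rcons => /predU1P[->|/ra ray] _; [left|right].
have [x [xs px] xmax] := IHs ps hs; exists x.
  by rewrite mem_rcons inE xs orbT.
by move=> y; rewrite mem_rcons => /predU1P[->|ys]; [rewrite pa|apply: xmax].
Qed.

(** * Descent in the search tree *)

Variables (e lt : rel T) (K : nat).

Hypothesis e_asym : forall x y, e x y -> ~~ e y x.
Hypothesis near_class : forall a b, c a = c b -> near a b.
Hypothesis e_far : forall a b v, ~~ near a v -> c a = c b ->
  (e a v = e b v) * (e v a = e v b).
Hypothesis Z_type : forall v w z z', near x0 v -> near v w ->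
  z \in Z -> z' \in Z -> (e w z = e w z') * (e z w = e z' w).
Hypothesis Z_far : forall v w, near x0 v -> near v w -> w \notin Z.
Hypothesis lt_irr : irreflexive lt.
Hypothesis lt_trans : transitive lt.
Hypothesis X_class : {in X, forall x, c x = c x0}.
Hypothesis X_sep :
  {in X &, forall x y, lt x y -> exists2 z, z \in Z & lt x z && lt z y}.

Let N := [set c w | w in near x0].
Hypothesis N_le : #|N| <= K.

Let convex (V : seq T) : Prop :=
  {in V &, forall x y z, lt x z -> lt z y -> z \in V}.

Lemma convex_sep (V : seq T) x y : convex V -> x \in V -> y \in V ->
    x \in X -> y \in X -> lt x y ->
  exists z, [/\ z \in Z, z \in V, lt x z & lt z y].
Proof.
move=> cV xV yV xX yX /(X_sep xX yX)[z zZ /andP[xz zy]].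
by exists z; split=> //; apply: cV xz zy.
Qed.

Let lt_asym x y : lt x y -> ~~ lt y x.
Proof.
by move=> xy; apply/negP => yx; have := lt_trans xy yx; rewrite lt_irr.
Qed.

(* A and B collect the parts of the nodes that have already cut off the first,
   respectively the last, remaining vertex of X. *)
Lemma separated_count_rec (S : bintree T) (A B : {set C}) :
    search_tree e S -> pairwise lt (inorder S) -> convex (inorder S) ->
    A \subset N -> B \subset N ->
    {in A, forall q, escape e lt (inorder S) q} ->
    {in B, forall q, escape (flip e) (flip lt) (inorder S) q} ->
  #|A| + #|B| + count (mem X) (inorder S) <= K.*2.+2.
Proof.
have small (D : {set C}) : D \subset N -> #|D| <= K.
  by move=> DN; apply: leq_trans (subset_leq_card DN) N_le.
elim: S A B => [|l IHl w r IHr] A B.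
  by move=> _ _ _ /small AK /small BK _ _; rewrite -addn2 -addnn !leq_add.
set V := inorder _ => sS pV cV AN BN escA escB.
(* The summand 2 of the bound absorbs this case. With three or more vertices of [X] left, a child
   subtree that keeps all but one of them has two, hence a far vertex between them. *)
have [nV|nV] := leqP (count (mem X) V) 2.
  by rewrite -addn2 -addnn !leq_add ?small.
have /= /and4P[/allP lw /allP wr sl sr] := sS.
have := pV; rewrite /= pairwise_cat pairwise_cons.
case/and4P => /allrelP llt pl /allP ltr pr.
have lltw x : x \in inorder l -> lt x w.
  by move=> xl; apply: llt; rewrite ?inE ?eqxx.
have lltr x y : x \in inorder l -> y \in inorder r -> lt x y.
  by move=> xl yr; apply: llt; rewrite ?inE ?yr ?orbT.
have inV x : x \in V -> [\/ x \in inorder l, x = w | x \in inorder r].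
  rewrite mem_cat inE => /or3P[xl|/eqP xw|xr];
  by [constructor 1|constructor 2|constructor 3].
have wV : w \in V by rewrite mem_cat inE eqxx orbT.
have lV : {subset inorder l <= V} by move=> x; rewrite mem_cat => ->.
have rV : {subset inorder r <= V}.
  by move=> x; rewrite mem_cat inE => ->; rewrite !orbT.
have inl x z : x \in inorder l -> z \in V -> lt z x -> z \in inorder l.
  move=> xl /inV[//|->|zr] /lt_asym; first by rewrite lltw.
  by rewrite lltr.
have inr x z : x \in inorder r -> z \in V -> lt x z -> z \in inorder r.
  move=> xr /inV[zl|->|//] /lt_asym; first by rewrite lltr.
  by rewrite ltr.
have cl : convex (inorder l).
  move=> x y xl yl z xz zy; apply: (inl y) => //.
  by apply: cV xz zy; apply: lV.
have cr : convex (inorder r).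
  move=> x y xr yr z xz zy; apply: (inr x) => //.
  by apply: cV xz zy; apply: rV.
have escAr : {in A, forall q, escape e lt (inorder r) q}.
  move=> q /escA; apply: (@escape_right _ _ _ _ w) => // z /inV.
  by case=> [/lw|->|]; [constructor 3|constructor 2|constructor 1].
have escBl : {in B, forall q, escape (flip e) (flip lt) (inorder l) q}.
  move=> q /escB; apply: (@escape_right _ _ _ _ w) => // z /inV.
  by case=> [|->|/wr]; [constructor 1|constructor 2|constructor 3].
have escAl : has (mem X) (inorder l) ->
    {in A, forall q, escape e lt (inorder l) q}.
  case/hasP => x xl xX q /escA; apply: (@escape_left _ _ _ _ x) => // z zV.
  exact: inl.
have escBr : has (mem X) (inorder r) ->
    {in B, forall q, escape (flip e) (flip lt) (inorder r) q}.
  case/hasP => x xr xX q /escB; apply: (@escape_left _ _ _ _ x) => // z zV.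
  exact: inr.
have : count (mem X) V =
  count (mem X) (inorder l) + (w \in X) + count (mem X) (inorder r).
  by rewrite count_cat /= addnA.
move: nV; set n := count _ V; set nl := count _ (inorder l).
set nr := count _ (inorder r) => n_gt nE.
have nlE : has (mem X) (inorder l) = (0 < nl) by rewrite has_count.
have nrE : has (mem X) (inorder r) = (0 < nr) by rewrite has_count.
have Xw : w \in X -> near x0 w by move=> /X_class cw; apply: near_class.
(* If [w] is not near [x0], it is oriented alike towards all of [X], so the remaining vertices of
   [X] lie in one child subtree and nothing is cut off. *)
have [nw|fw] := boolP (near x0 w); last first.
  have wX : w \in X = false by apply: contraNF fw.
  have [nl0|nl_gt0] := posnP nl.
    have nrn : nr = n by rewrite nE nl0 wX.
    have hr : has (mem X) (inorder r) by rewrite nrE nrn (leq_trans _ n_gt).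
    by have := IHr A B sr pr cr AN BN escAr (escBr hr); rewrite -/nr nrn.
  have [nr0|nr_gt0] := posnP nr.
    have nln : nl = n by rewrite nE nr0 wX !addn0.
    have hl : has (mem X) (inorder l) by rewrite nlE nln (leq_trans _ n_gt).
    by have := IHl A B sl pl cl AN BN (escAl hl) escBl; rewrite -/nl nln.
  move: nl_gt0 nr_gt0; rewrite -nlE -nrE => /hasP[x xl xX] /hasP[y yr yX].
  have [_ ex] := e_far fw (esym (X_class xX)).
  have [_ ey] := e_far fw (esym (X_class yX)).
  by have := e_asym (lw x xl); rewrite -ex ey wr.
have nww : near w w by apply: near_class.
have wZ : w \notin Z by apply: Z_far nw nww.
have oneside y z : y \in Z -> z \in Z ->
    y \in inorder l -> z \in inorder r -> False.
  move=> yZ zZ /lw yw /wr; rewrite -(Z_type nw nww yZ zZ).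
  by apply/negP/e_asym.
have lwV x : x \in rcons (inorder l) w -> x \in V /\ (x = w \/ lt x w).
  rewrite mem_rcons => /predU1P[->|xl]; first by split; [|left].
  by split; [apply: lV|right; apply: lltw].
have wrV x : x \in w :: inorder r -> x \in V /\ (x = w \/ lt w x).
  rewrite inE => /predU1P[->|xr]; first by split; [|left].
  by split; [apply: rV|right; apply: ltr].
have Zl : 1 < nl + (w \in X) -> exists2 z, z \in Z & z \in inorder l.
  have -> : nl + (w \in X) = count (mem X) (rcons (inorder l) w).
    by rewrite -cats1 count_cat /= addn0.
  case/(@pairwise_count2 lt).
    rewrite pairwise_rcons pl andbT; exact/allP.
  move=> x [y [/lwV[xV _] /lwV[yV yw] xX yX xy]].
  have [z [zZ zV _ zy]] := convex_sep cV xV yV xX yX xy.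
  exists z => //; have zw : lt z w.
    by case: yw => [<-//|]; apply: lt_trans.
  by case: (inV z zV) => // [zw'|/ltr/lt_asym/negP//]; rewrite zw' lt_irr in zw.
have Zr : 1 < nr + (w \in X) -> exists2 z, z \in Z & z \in inorder r.
  have -> : nr + (w \in X) = count (mem X) (w :: inorder r) by rewrite addnC.
  case/(@pairwise_count2 lt).
    rewrite pairwise_cons pr andbT; exact/allP.
  move=> x [y [/wrV[xV xw] /wrV[yV _] xX yX xy]].
  have [z [zZ zV xz _]] := convex_sep cV xV yV xX yX xy.
  exists z => //; have wz : lt w z.
    by case: xw => [<-//|wx]; apply: lt_trans xz.
  by case: (inV z zV) => // [/lltw/lt_asym/negP//|zw']; rewrite zw' lt_irr in wz.
(* By [oneside], far vertices occur in at most one child subtree, so by [Zl] and [Zr] the node [w]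
   cuts off at most one vertex of [X]. *)
have [nlw|/Zl[z1 z1Z z1l]] := leqP (nl + (w \in X)) 1.
- have nle : n <= 1 + nr by rewrite nE leq_add2r.
  have nr2 : 1 < nr by rewrite -(ltn_add2l 1) (leq_trans n_gt).
  have [|z zZ zr] := Zr; first by rewrite ltn_addr.
  have hr : has (mem X) (inorder r) by rewrite nrE ltnW.
  have [[x xlw xX]|Xlw] := altP (@hasP _ (mem X) (rcons (inorder l) w));
    last first.
    have nrn : nr = n.
      move: Xlw; rewrite has_rcons negb_or nlE -eqn0Ngt nE.
      by case/andP=> wX /eqP->; rewrite (negPf (wX : w \notin X)).
    by have := IHr A B sr pr cr AN BN escAr (escBr hr); rewrite -/nr nrn.
  have [xV xw] := lwV x xlw.
  have cwA : c w \notin A.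
    apply/negP => /escA; apply:
      (@escape_fresh e lt e_asym e_far Z_type Z_far _ w z x) => //.
    + exact: rV.
    + exact: wr.
    move=> y /inV[/lw//|->|/ltr wy] yx; case: xw yx => [->|xw].
    + by rewrite lt_irr.
    + by move/lt_asym; rewrite xw.
    + by move/lt_asym; rewrite wy.
    + by move/(lt_trans wy)/lt_asym; rewrite xw.
  (* The far vertex [t] between the lost [x] and the first surviving [m] is the witness with which
     the part of [w] enters [A]. The gain in [A] pays for the loss of [x]. *)
  have [m [mr mX] m_min] := pairwise_min pr hr.
  have xm : lt x m.
    by case: xw => [->|/lt_trans]; [apply: ltr|apply; apply: ltr].
  have [t [tZ tV xt tm]] := convex_sep cV xV (rV m mr) xX mX xm.
  have tr : t \in inorder r.
    case: (inV t tV) => // [tl|tw]; first by case: (oneside t z).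
    by move: wZ; rewrite -tw tZ.
  have := IHr (c w |: A) B sr pr cr _ BN _ (escBr hr).
  rewrite cardsU1 cwA -/nr subUset sub1set AN andbT imset_f //.
  move=> /(_ isT) IH; apply: leq_trans (IH _); first by move: nle; clear; lia.
  move=> q /setU1P[->|/escAr//]; exists w, t; split=> //.
  left; split=> // y yr yX; case: (m_min y yr yX) => [->//|].
  exact: lt_trans.
(* Mirror image: [w] can only cut off the last vertex of [X], and [escape_fresh] is applied to the
   reversed orientation and order. *)
- have [nrw|/Zr[z2 z2Z z2r]] := leqP (nr + (w \in X)) 1; last first.
    by case: (oneside z1 z2).
  have nle : n <= 1 + nl.
    by rewrite nE -addnA [_ + nr]addnC addnC leq_add2r.
  have nl2 : 1 < nl by rewrite -(ltn_add2l 1) (leq_trans n_gt).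
  have hl : has (mem X) (inorder l) by rewrite nlE ltnW.
  have [[x xwr xX]|Xwr] := altP (@hasP _ (mem X) (w :: inorder r)); last first.
    have nln : nl = n.
      move: Xwr; rewrite /= negb_or nrE -eqn0Ngt nE.
      by case/andP=> wX /eqP->; rewrite (negPf (wX : w \notin X)) !addn0.
    by have := IHl A B sl pl cl AN BN (escAl hl) escBl; rewrite -/nl nln.
  have [xV wx] := wrV x xwr.
  have cwB : c w \notin B.
    apply/negP => /escB; apply:
      (@escape_fresh (flip e) (flip lt) _ _ _ Z_far _ w z1 x) => //.
    + by move=> a b; apply: e_asym.
    + by move=> a b v nav cab; have [h1 h2] := e_far nav cab; split.
    + move=> v u y y' nv nu yZ y'Z.
      by have [h1 h2] := Z_type nv nu yZ y'Z; split.
    + exact: lV.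
    + exact: lw.
    move=> y /inV[/lltw yw|->|/wr//]; rewrite /flip => xy;
      case: wx xy => [->|wx].
    + by move/lt_asym; rewrite yw.
    + by move=> xy; have := lt_asym (lt_trans wx xy); rewrite yw.
    + by rewrite lt_irr.
    + by move/lt_asym; rewrite wx.
  have [m [ml mX] m_max] := pairwise_max pl hl.
  have mx : lt m x.
    have mw := lltw m ml.
    by case: wx => [->//|]; apply: lt_trans.
  have [t [tZ tV mt tx]] := convex_sep cV (lV m ml) xV mX xX mx.
  have tl : t \in inorder l.
    case: (inV t tV) => // [tw|tr]; last by case: (oneside z1 t).
    by move: wZ; rewrite -tw tZ.
  have := IHl A (c w |: B) sl pl cl AN _ (escAl hl).
  rewrite cardsU1 cwB -/nl subUset sub1set BN andbT imset_f //.
  move=> /(_ isT) IH; apply: leq_trans (IH _); first by move: nle; clear; lia.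
  move=> q /setU1P[->|/escBl//]; exists w, t; split=> //.
  left; split=> // y yl yX; rewrite /flip.
  by case: (m_max y yl yX) => [->//|ym]; apply: lt_trans mt.
Qed.

Lemma separated_card (S : bintree T) :
    perm_eq (inorder S) (enum T) -> search_tree e S ->
    pairwise lt (inorder S) ->
  #|X| <= K.*2.+2.
Proof.
move=> pS sS lS; have allS x : x \in inorder S.
  by rewrite (perm_mem pS) mem_enum.
have := @separated_count_rec S set0 set0 sS lS.
rewrite (permP pS) cards0 !add0n !sub0set cardE enumT size_filter.
by apply=> // [q|q]; rewrite inE.
Qed.

End SeparatedClass.

(** * Balls and runs *)

Lemma card_bigcup_le (I T : finType) (A : {set I}) (F : I -> {set T}) m n :
  #|A| <= m -> {in A, forall i, #|F i| <= n} ->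
  #|\bigcup_(i in A) F i| <= m * n.
Proof.
move=> Am Fn; apply: (@leq_trans (\sum_(i in A) n)); last first.
  by rewrite sum_nat_const leq_mul2r Am orbT.
elim/big_rec2: _ => [|i k U iA Uk]; first by rewrite cards0.
by rewrite (leq_trans (leq_card_setU _ _)) // leq_add // Fn.
Qed.

Section Balls.

Variables (T : finType) (e : rel T).
Implicit Types (P Q : {set {set T}}) (X Y Z : {set T}).

Lemma homogeneous_sym (Rs : seq (rel T)) X Y :
  homogeneous Rs X Y = homogeneous Rs Y X.
Proof. by apply: eq_all => R; rewrite andbC. Qed.

Lemma homogeneousS (Rs : seq (rel T)) X Y X' Y' :
  X \subset X' -> Y \subset Y' -> homogeneous Rs X' Y' -> homogeneous Rs X Y.
Proof.
have uS (R : rel T) (A B A' B' : {set T}) : A \subset A' -> B \subset B' ->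
    uniform R A' B' -> uniform R A B.
  move=> /subsetP AA' /subsetP BB' /orP[]/forall_inP h; apply/orP.
    by left; apply/forall_inP=> x /AA'/h/forall_inP hx;
      apply/forall_inP=> y /BB'/hx.
  by right; apply/forall_inP=> x /AA'/h/forall_inP hx;
    apply/forall_inP=> y /BB'/hx.
move=> XX' YY'; apply: sub_all => R /andP[u v].
by rewrite (uS R _ _ _ _ XX' YY' u) (uS R _ _ _ _ YY' XX' v).
Qed.

Lemma uniform_eq (R : rel T) X Y x y x' y' : uniform R X Y ->
  x \in X -> x' \in X -> y \in Y -> y' \in Y -> R x y = R x' y'.
Proof.
case/orP=> /forall_inP h xX x'X yY y'Y.
  by rewrite (forall_inP (h x xX)) // (forall_inP (h x' x'X)).
by rewrite (negPf (forall_inP (h x xX) y yY))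
  (negPf (forall_inP (h x' x'X) y' y'Y)).
Qed.

(** Closed balls in the red graph of [P]. A part outside [ball3] of [X] is homogeneous to every part
    in [ball2] of [X], which is as far as the descent looks: a node [w] adjacent to [X], then a node
    [u] adjacent to [w]. *)
Definition ball1 P X := [set Y in P | (Y == X) || ~~ homogeneous [:: e] X Y].
Definition ball2 P X := \bigcup_(Y in ball1 P X) ball1 P Y.
Definition ball3 P X := \bigcup_(Y in ball2 P X) ball1 P Y.

Lemma ball1_sym P X Y : X \in P -> Y \in P ->
  (Y \in ball1 P X) = (X \in ball1 P Y).
Proof. by move=> XP YP; rewrite !inE XP YP eq_sym homogeneous_sym. Qed.

Lemma ball1P P X Y : Y \in ball1 P X -> Y \in P.
Proof. by rewrite inE => /andP[]. Qed.

Lemma ball3_sym P X Y : X \in P -> Y \in P -> Y \in ball3 P X -> X \in ball3 P Y.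
Proof.
move=> XP YP /bigcupP[Z /bigcupP[W W1 Z1] Y1].
have [WP ZP] := (ball1P W1, ball1P Z1).
apply/bigcupP; exists W; last by rewrite ball1_sym.
by apply/bigcupP; exists Z; rewrite -ball1_sym.
Qed.

Lemma ball1_refl P X : X \in P -> X \in ball1 P X.
Proof. by move=> XP; rewrite inE XP eqxx. Qed.

Lemma ball1S2 P X : X \in P -> ball1 P X \subset ball2 P X.
Proof. by move=> XP; apply: (bigcup_sup X) => //; apply: ball1_refl. Qed.

Lemma ball2S3 P X : ball2 P X \subset ball3 P X.
Proof.
apply/subsetP=> Y Y2; apply/bigcupP; exists Y => //; apply: ball1_refl.
by case/bigcupP: Y2 => Z _ /ball1P.
Qed.

Lemma card_ball1 P X :
  X \in P -> #|ball1 P X| <= (red_degree [:: e] P X).+1.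
Proof.
move=> XP; rewrite -add1n -(cards1 X).
apply: leq_trans (leq_card_setU _ _); apply: subset_leq_card.
by apply/subsetP => Y; rewrite !inE; case: eqP => //= _ /andP[-> ->].
Qed.

Section Card.
Variables (P : {set {set T}}) (K : nat).
Hypothesis PK : {in P, forall X, #|ball1 P X| <= K}.

Lemma card_ball2 X : X \in P -> #|ball2 P X| <= K * K.
Proof. by move=> XP; apply: card_bigcup_le => [|Y /ball1P]; apply: PK. Qed.

Lemma card_ball3 X : X \in P -> #|ball3 P X| <= K * K * K.
Proof.
move=> XP; apply: card_bigcup_le => [|Y]; first exact: card_ball2.
by case/bigcupP=> Z _ /ball1P; apply: PK.
Qed.
End Card.

End Balls.

Lemma partition_pblock (T : finType) (P : {set {set T}}) x :
  partition P [set: T] -> x \in pblock P x /\ pblock P x \in P.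
Proof. by case/and3P=> /eqP cP _ _; rewrite mem_pblock pblock_mem cP. Qed.

Lemma partition_eq_pblock (T : finType) (P : {set {set T}}) x y :
  partition P [set: T] -> (pblock P x == pblock P y) = (y \in pblock P x).
Proof. by case/and3P=> /eqP cP tP _; rewrite eq_pblock ?cP. Qed.

Lemma partition_def_pblock (T : finType) (P : {set {set T}}) X x :
  partition P [set: T] -> X \in P -> x \in X -> pblock P x = X.
Proof. by case/and3P=> _ tP _; apply: def_pblock. Qed.

(** * The number of runs in one part *)

Section Runs.

Variables (T : finType) (e : rel T) (S : bintree T).
Hypotheses (e_tournament : tournament e) (S_bst : bst e S).
Implicit Types (P Q : {set {set T}}).

Let lt := bst_order S.

Lemma mem_inorder x : x \in inorder S.
Proof. by case: S_bst => pS _; rewrite (perm_mem pS) mem_enum. Qed.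

Lemma bst_order_irr : irreflexive lt.
Proof. by move=> x; apply: ltnn. Qed.

Lemma bst_order_trans : transitive lt.
Proof. by move=> x y z; apply: ltn_trans. Qed.

Lemma bst_order_total x y : x != y -> lt x y || lt y x.
Proof.
move=> xy; rewrite /lt /bst_order -neq_ltn; apply: contraNneq xy => xy.
by rewrite -(nth_index x (mem_inorder x)) xy nth_index // mem_inorder.
Qed.

Lemma bst_order_asym x y : lt x y -> lt y x = false.
Proof. by move=> xy; apply: contraTF xy; rewrite -leqNgt; apply: ltnW. Qed.

Lemma pairwise_bst_order : pairwise lt (inorder S).
Proof.
have uS : uniq (inorder S) by case: S_bst => pS _; rewrite (perm_uniq pS) enum_uniq.
case sE: (inorder S) => [//|x s]; rewrite -sE; apply/(pairwiseP x) => i j iS jS.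
by rewrite /lt /bst_order !index_uniq.
Qed.

Lemma tournament_asym x y : e x y -> ~~ e y x.
Proof.
case: e_tournament => e0 eT; have [->|/eT] := eqVneq x y; first by rewrite e0.
by case: (e x y) => //= /negPf->.
Qed.

Lemma tournament_opp x y : x != y -> e y x = ~~ e x y.
Proof. by case: e_tournament => _ eT /eT; case: (e x y); case: (e y x). Qed.

Definition between x z y :=
  bst_order S x z && bst_order S z y || bst_order S y z && bst_order S z x.

Definition run P : rel T := fun x y => (pblock P x == pblock P y) &&
  [forall z, between x z y ==> (pblock P z \in ball3 e P (pblock P x))].

Variables (P : {set {set T}}) (K : nat).
Hypotheses (P_part : partition P [set: T])
  (P_deg : {in P, forall X, #|ball1 e P X| <= K}).

Let p := pblock P.
Let pP x : p x \in P. Proof. by case: (partition_pblock x P_part). Qed.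
Let px x : x \in p x. Proof. by case: (partition_pblock x P_part). Qed.

Lemma far_uniform a b v w : p v \notin ball1 e P (p a) ->
  p a = p b -> p v = p w -> (e a v = e b w) * (e v a = e w b).
Proof.
rewrite inE pP negb_or negbK /= andbT => /andP[_ /andP[u1 u2]] ab vw.
have [bX wX] : b \in p a /\ w \in p v by rewrite ab vw.
by split; [apply: (uniform_eq u1)|apply: (uniform_eq u2)].
Qed.

(** [M] picks at most one vertex from each run. Consecutive vertices of [M] are separated by far
    vertices; these have at most [2 ^ (K * K)] types over [ball2], and [separated_card] bounds the
    vertices of [M] of each type. *)
Lemma run_count (M : {set T}) X0 : {in M, forall x, p x = X0} ->
    {in M &, forall x y, run P x y -> x = y} ->
  #|M| <= (2 ^ (K * K) * K.*2.+2).+1.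
Proof.
move=> MX Mrun; have [->|[x0 x0M]] := set_0Vmem M; first by rewrite cards0.
(* All of [M] but its last vertex, which accounts for the successor in the bound. *)
pose M' := [set x in M | [exists y in M, lt x y]].
have Mx x : x \in M -> p x = p x0 by move=> /MX->; rewrite (MX x0).
have le1 : #|M :\: M'| <= 1.
  apply/card_le1_eqP => x y; rewrite !inE => /andP[xM' xM] /andP[yM' yM].
  apply/eqP/negPn/negP => /bst_order_total /orP[yx|xy].
    by case/negP: yM'; rewrite yM /=; apply/exists_inP; exists x.
  by case/negP: xM'; rewrite xM /=; apply/exists_inP; exists y.
rewrite -(cardsID M' M) -addn1 leq_add //.
rewrite (setIidPr _); last by apply/subsetP=> x; rewrite inE => /andP[].
(* [f x] is a far vertex between [x] and its successor [y] in [M]; it exists because [x] and [y] are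
   in different runs. Outside [M'] the value is arbitrary. *)
have /fin_all_exists[f fP] x : exists z, x \in M' ->
    [/\ p z \notin ball3 e P (p x0), lt x z &
      {in M, forall y, lt x y -> lt z y}].
  have [xM'|] := boolP (x \in M'); last by exists x.
  move: xM'; rewrite inE => /andP[xM /exists_inP[y1 y1M xy1]].
  have Py1 : [pred y in M | lt x y] y1 by rewrite /= y1M.
  case: (@arg_minnP _ y1 [pred y in M | lt x y]
    (fun y => index y (inorder S)) Py1) => y /andP[yM xy] ymin.
  have : ~~ run P x y.
    by apply: contraTN xy => /(Mrun x y xM yM) ->; rewrite bst_order_irr.
  rewrite /run -/p (Mx x xM) (Mx y yM) eqxx => /forallPn[z].
  rewrite negb_imply => /andP[]; rewrite /between => /orP[]/andP[xz zy] zfar.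
    exists z => _; split=> // u uM xu; apply: leq_trans zy (ymin u _).
    by rewrite /= uM xu.
  by have := bst_order_trans xz zy; rewrite bst_order_asym.
(* The type of x: the nearby parts that point towards f x. *)
pose t x := [set p q | q in [pred q | (p q \in ball2 e P (p x0)) && e q (f x)]].
have t_sub x : t x \in powerset (ball2 e P (p x0)).
  by rewrite inE; apply/subsetP=> _ /imsetP[q /andP[q2 _] ->].
have far q x : p q \in ball2 e P (p x0) -> x \in M' ->
    p (f x) \notin ball1 e P (p q).
  move=> q2 /fP[fx _ _]; apply: contra fx => fq.
  by apply/bigcupP; exists (p q).
have near2 v w : p v \in ball1 e P (p x0) -> p w \in ball1 e P (p v) ->
    p w \in ball2 e P (p x0).
  by move=> v1 w1; apply/bigcupP; exists (p v).
have typ q x y : p q \in ball2 e P (p x0) -> x \in M' -> y \in M' ->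
    t x = t y -> e q (f x) -> e q (f y).
  move=> q2 xM' yM' txy eqx; have : p q \in t x.
    by apply: imset_f; rewrite inE q2.
  rewrite txy => /imsetP[r /andP[r2 er] qr].
  by have [-> _] := far_uniform (far q y q2 yM') qr erefl.
have fq q x : p q \in ball2 e P (p x0) -> x \in M' -> q != f x.
  move=> q2 xM'; apply: contraNneq (far q x q2 xM') => <-.
  exact: ball1_refl.
apply: (@leq_trans (\sum_(tau in powerset (ball2 e P (p x0))) K.*2.+2)); last first.
  rewrite sum_nat_const leq_mul2r card_powerset leq_exp2l //.
  by rewrite card_ball2 ?orbT.
rewrite -sum1_card (partition_big t (mem (powerset (ball2 e P (p x0))))) //=.
apply: leq_sum => tau _; pose X := [set x in M' | t x == tau].
have XE x : x \in X -> x \in M' /\ t x = tau.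
  by rewrite inE => /andP[xM' /eqP].
have XM x : x \in X -> x \in M by case/XE; rewrite inE => /andP[].
have -> : \sum_(x in M' | t x == tau) 1 = #|X|.
  by rewrite -sum1_card; apply: eq_bigl => x; rewrite [RHS]inE.
apply: (@separated_card _ _ p (fun a b => p b \in ball1 e P (p a)) x0 X
  [set f x | x in X] e lt K _ _ _ _ _ _ _ _ _ _ S) => //.
- exact: tournament_asym.
- by move=> a b ab; rewrite ab ball1_refl.
- by move=> a b v av ab; apply: far_uniform.
- move=> v w _ _ v1 w1 /imsetP[x /XE[xM' tx] ->] /imsetP[y /XE[yM' ty] ->].
  have w2 := near2 v w v1 w1.
  have eE : e w (f x) = e w (f y).
    by apply/idP/idP; apply: typ; rewrite ?tx ?ty.
  (* The type records only arcs towards [f x]. The reverse arcs follow since [w] differs from [f x]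
     and [f y]. *)
  by rewrite !(@tournament_opp w) ?fq // eE.
- move=> v w v1 w1; apply/imsetP => -[x /XE[xM' _] wx].
  by have := fq w x (near2 v w v1 w1) xM'; rewrite wx eqxx.
- exact: bst_order_irr.
- exact: bst_order_trans.
- by move=> x /XM /Mx.
- move=> x y xX yX xy; exists (f x); first exact: imset_f.
  have [xM' _] := XE x xX; have [_ -> fxy] := fP x xM'.
  by rewrite fxy ?XM.
- apply: leq_trans (P_deg (pP x0)); apply: subset_leq_card.
  by apply/subsetP => _ /imsetP[w w1 ->].
- by case: S_bst.
- by case: S_bst.
- exact: pairwise_bst_order.
Qed.

End Runs.

(** * Contractions between nested partitions *)

Section Refines.

Variable T : finType.
Implicit Types (P Q R : {set {set T}}) (X Y Z : {set T}).

Definition refines P Q := forall x, pblock P x \subset pblock Q x.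

Lemma partition_neq0 P X :
  partition P [set: T] -> X \in P -> exists x, X = pblock P x.
Proof.
move=> pP XP; have /set0Pn[x xX] : X != set0.
  by apply: contraTneq XP => ->; case/and3P: pP.
by exists x; rewrite (partition_def_pblock pP XP xX).
Qed.

Lemma partition_ext P Q : partition P [set: T] -> partition Q [set: T] ->
  (forall x, pblock P x = pblock Q x) -> P = Q.
Proof.
move=> pP pQ PQ; apply/setP => X; apply/idP/idP.
  by case/(partition_neq0 pP) => x ->; rewrite PQ; case: (partition_pblock x pQ).
by case/(partition_neq0 pQ) => x ->; rewrite -PQ; case: (partition_pblock x pP).
Qed.

Lemma refines_pblock_eq P Q x y : partition P [set: T] ->
  partition Q [set: T] -> refines P Q ->
  pblock P x = pblock P y -> pblock Q x = pblock Q y.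
Proof.
move=> pP pQ PQ /eqP; rewrite partition_eq_pblock // => /(subsetP (PQ x)).
by rewrite -partition_eq_pblock // => /eqP.
Qed.

Lemma partition_singletons : partition [set [set x] | x : T] [set: T].
Proof.
apply/and3P; split.
- rewrite eqEsubset subsetT; apply/subsetP => x _; apply/bigcupP.
  by exists [set x]; rewrite ?set11 ?imset_f.
- apply/trivIsetP => _ _ /imsetP[x _ ->] /imsetP[y _ ->] xy.
  by rewrite disjoints1 inE; apply: contraNneq xy => ->.
- by apply/imsetP => -[x _ /esym/eqP]; rewrite -subset0 sub1set inE.
Qed.

Section Merge.

Variables (P : {set {set T}}) (X Y : {set T}).
Hypotheses (P_part : partition P [set: T]) (XP : X \in P) (YP : Y \in P).
Hypothesis XY : X != Y.

Let P1 := (X :|: Y) |: (P :\: [set X; Y]).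

Lemma merge_partition : partition P1 [set: T].
Proof.
have YPX : Y \in P :\ X by rewrite !inE eq_sym XY.
have pD : partition (P :\: [set X; Y]) ([set: T] :\: (X :|: Y)).
  by rewrite -!setDDl; apply: partitionD1 YPX; apply: partitionD1.
rewrite -(setID [set: T] (X :|: Y)) setTI; apply: partitionU1 => //.
  have [x XE] := partition_neq0 P_part XP.
  by apply/set0Pn; exists x; rewrite inE XE; case: (partition_pblock x P_part) => ->.
by rewrite -setI_eq0 setIDA setIT setDv.
Qed.

Lemma merge_card : #|P1|.+1 = #|P|.
Proof.
have nU : X :|: Y \notin P :\: [set X; Y].
  apply/negP; rewrite !inE negb_or => /andP[/andP[UX _] UP].
  have [x XE] := partition_neq0 P_part XP.
  have [xX _] := partition_pblock x P_part; rewrite -XE in xX.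
  have xU : x \in X :|: Y by rewrite inE xX.
  case/negP: UX; apply/eqP.
  by rewrite -(partition_def_pblock P_part UP xU) XE.
rewrite /P1 cardsU1 nU -setDDl (cardsD1 X P) XP (cardsD1 Y (P :\ X)).
by rewrite !inE eq_sym XY YP.
Qed.

Lemma merge_pblock x : pblock P1 x =
  if pblock P x \in [set X; Y] then X :|: Y else pblock P x.
Proof.
have [xp pP] := partition_pblock x P_part.
case: ifP => [pXY|pXY]; apply: (partition_def_pblock merge_partition) => //.
- by rewrite inE set11.
- by move: pXY xp; rewrite !inE => /orP[]/eqP-> ->; rewrite ?orbT.
- by rewrite inE in_setD pXY pP orbT.
Qed.

Lemma refines_merge : refines P P1.
Proof.
move=> x; rewrite merge_pblock; case: ifP => //.
by rewrite !inE => /orP[]/eqP->; rewrite ?subsetUl ?subsetUr.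
Qed.

Lemma merge_refines Q Z : partition Q [set: T] -> refines P Q ->
  Z \in Q -> X \subset Z -> Y \subset Z -> refines P1 Q.
Proof.
move=> pQ PQ ZQ XZ YZ x; rewrite merge_pblock; case: ifP => // pXY.
have [xp _] := partition_pblock x P_part.
have xZ : x \in Z.
  by move: pXY xp; rewrite !inE => /orP[]/eqP->; apply/subsetP.
by rewrite (partition_def_pblock pQ ZQ xZ) subUset XZ.
Qed.

End Merge.

Variables (Rs : seq (rel T)) (D : nat).

(** A segment of a contraction sequence. Only the partitions after [P] are listed, so segments
    concatenate without repetition; the size equation later yields the length [#|T|] of the whole
    sequence. *)
Definition contracts P Q := exists s,
  [/\ path (@merges T) P s, last P s = Q, size s + #|Q| = #|P|,
      all (fun R => partition R [set: T]) s &
      all (fun R => [forall X in R, red_degree Rs R X <= D]) s].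

Lemma contracts_refl P : contracts P P.
Proof. by exists [::]. Qed.

Lemma contracts_trans Q P R : contracts P Q -> contracts Q R -> contracts P R.
Proof.
move=> [s [ms ls ss ps ds]] [t [mt lt st pt dt]]; exists (s ++ t).
by rewrite cat_path last_cat ls ms mt size_cat !all_cat ps pt ds dt -addnA st.
Qed.

(** As long as two parts of [P] lie in one part of [Q], merge them. Every partition met on the way
    lies between [P] and [Q]. *)
Lemma refines_contracts P Q :
    partition P [set: T] -> partition Q [set: T] -> refines P Q ->
    (forall R X, partition R [set: T] -> refines P R -> refines R Q ->
      X \in R -> red_degree Rs R X <= D) ->
  contracts P Q.
Proof.
have [n] := ubnP #|P|; elim: n P => // n IHn P /ltnSE Pn pP pQ PQ deg.
have [/exists_inP[X XP /exists_inP[Y YP]]|noXY] :=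
  boolP [exists X in P, exists Y in P, (X != Y) &&
    [exists Z in Q, (X \subset Z) && (Y \subset Z)]].
  case/andP=> XY /exists_inP[Z ZQ /andP[XZ YZ]].
  pose P1 := (X :|: Y) |: (P :\: [set X; Y]).
  have pP1 : partition P1 [set: T] by apply: merge_partition.
  have PP1 : refines P P1 by apply: refines_merge.
  have P1Q : refines P1 Q by apply: merge_refines YZ.
  have cP1 : #|P1|.+1 = #|P| by apply: merge_card.
  apply: (@contracts_trans P1); last first.
    apply: IHn => //; first by rewrite cP1.
    move=> R W pR P1R RQ WR; apply: deg => // x.
    exact: subset_trans (PP1 x) (P1R x).
  exists [:: P1]; split=> //=; last 2 first.
  - by rewrite pP1.
  - by rewrite andbT; apply/forall_inP=> W; apply: deg.
  rewrite andbT; apply/exists_inP; exists X => //; apply/exists_inP.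
  by exists Y; rewrite ?XY /=.
suff -> : P = Q by apply: contracts_refl.
apply: partition_ext => // x; apply/eqP; rewrite eqEsubset PQ.
apply/subsetP => y; rewrite -partition_eq_pblock // => /eqP xyQ.
apply: contraNT noXY; rewrite -partition_eq_pblock // => xyP.
have [[_ xP] [_ yP]] := (partition_pblock x pP, partition_pblock y pP).
apply/exists_inP; exists (pblock P x) => //.
apply/exists_inP; exists (pblock P y) => //; rewrite xyP /=.
apply/exists_inP; exists (pblock Q x); rewrite ?PQ ?xyQ ?PQ //.
by case: (partition_pblock y pQ).
Qed.

Lemma tww_contracts :
  0 < #|T| -> contracts [set [set x] | x : T] [set [set: T]] -> tww Rs <= D.
Proof.
move=> T0 [s [ms ls ss ps ds]]; set P := imset _ _ in ms ls ss.
have cP : #|P| = #|T| by rewrite card_imset //; apply: set1_inj.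
have sz : size (P :: s) == #|T| by rewrite -cP -ss cards1 addn1.
apply: (@leq_trans (width Rs (Tuple sz))).
  apply: tww_le; apply/and4P; split; rewrite /= ?ls //.
  by rewrite ps partition_singletons.
rewrite /width; apply/bigmax_leqP_seq => R; rewrite inE => /predU1P[->|Rs1] _; last first.
  by apply/bigmax_leqP => X; move/allP: ds => /(_ R Rs1)/forall_inP; apply.
(* The initial partition is not covered by [contracts], but two singletons are always
   homogeneous. *)
apply/bigmax_leqP => _ /imsetP[x _ ->]; apply: (@leq_trans 0) => //; rewrite leqn0 cards_eq0.
apply/eqP/setP => Y; rewrite !inE; apply: contraTF isT => /andP[/andP[_]].
case/imsetP=> y _ ->; case/negP.
have u1 (r : rel T) a b : uniform r [set a] [set b].
  rewrite /uniform; case rab: (r a b); apply/orP; [left|right];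
  by apply/forall_inP=> u /set1P->; apply/forall_inP=> v /set1P->; rewrite rab.
rewrite /homogeneous.
by elim: Rs => //= r l IH; rewrite !u1.
Qed.

End Refines.

(** * The sequence of run partitions *)

Section RunPartition.

Variables (T : finType) (e : rel T) (S : bintree T).
Hypotheses (e_tournament : tournament e) (S_bst : bst e S).
Implicit Types (P Q R : {set {set T}}) (A B X Y : {set T}).

Lemma run_equiv P : partition P [set: T] ->
  {in [set: T] & &, equivalence_rel (run e S P)}.
Proof.
move=> pP; have refl x : run e S P x x.
  rewrite /run eqxx; apply/forallP => z; apply/implyP.
  by case/orP=> /andP[xz]; rewrite (bst_order_asym xz).
have sym x y : run e S P x y -> run e S P y x.
  case/andP=> /eqP xy /forallP far; rewrite /run xy eqxx.
  apply/forallP => z; apply/implyP => yz; rewrite -xy.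
  by apply: (implyP (far z)); move: yz; rewrite /between orbC.
have trans x y z : run e S P x y -> run e S P y z -> run e S P x z.
  case/andP=> /eqP xy /forallP xfar /andP[/eqP yz /forallP yfar].
  rewrite /run xy yz eqxx; apply/forallP => u; apply/implyP => xuz.
  (* A vertex between [x] and [z] is [y], which is in their part, or lies between [x] and [y] or
     between [y] and [z]. *)
  have [uy|uy] := eqVneq u y.
    rewrite uy yz; have [_ zP] := partition_pblock z pP.
    by apply: (subsetP (ball2S3 e P _)); apply: (subsetP (ball1S2 e zP));
      apply: ball1_refl.
  have := xfar u; rewrite xy yz; have := yfar u; rewrite yz.
  move=> /implyP yu /implyP xu; move: xuz xu yu; rewrite /between.
  have /orP[h|h] := bst_order_total S_bst uy; case/orP => /andP[h1 h2] xu yu;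
  [apply: xu|apply: yu|apply: yu|apply: xu]; by rewrite h ?h1 ?h2 ?orbT.
move=> x y z _ _ _; split=> // xy; apply/idP/idP; last exact: trans.
exact/trans/sym.
Qed.

Definition run_partition P := equivalence_partition (run e S P) [set: T].

Lemma run_partitionP P :
  partition P [set: T] -> partition (run_partition P) [set: T].
Proof. by move=> pP; apply: equivalence_partitionP (run_equiv pP). Qed.

Lemma mem_run_partition P x y : partition P [set: T] ->
  (y \in pblock (run_partition P) x) = run e S P x y.
Proof.
by move=> pP; apply: (pblock_equivalence_partition (run_equiv pP)); rewrite inE.
Qed.

Lemma run_partition_refines P :
  partition P [set: T] -> refines (run_partition P) P.
Proof.
move=> pP x; apply/subsetP => y; rewrite mem_run_partition // => /andP[xy _].
by rewrite -partition_eq_pblock.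
Qed.

Lemma run_partition_id P : partition P [set: T] ->
  (forall x, pblock P x \subset pblock (run_partition P) x) ->
  run_partition P = P.
Proof.
move=> pP h; apply: partition_ext => // [|x]; first exact: run_partitionP.
by apply/eqP; rewrite eqEsubset h run_partition_refines.
Qed.

Lemma run_partition_singletons :
  run_partition [set [set x] | x : T] = [set [set x] | x : T].
Proof.
have pP := partition_singletons T; apply: run_partition_id => // x.
have xP : [set x] \in [set [set y] | y : T] by apply: imset_f.
rewrite (partition_def_pblock pP xP (set11 x)) sub1set.
by case: (partition_pblock x (run_partitionP pP)).
Qed.

Lemma run_partition_full : partition [set [set: T]] [set: T] ->
  run_partition [set [set: T]] = [set [set: T]].
Proof.
move=> pP; have pE x : pblock [set [set: T]] x = [set: T].
  by apply: partition_def_pblock pP _ _; rewrite ?set11.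
apply: run_partition_id => // x; apply/subsetP => y _.
rewrite mem_run_partition // /run !pE eqxx; apply/forallP => z.
apply/implyP => _; rewrite pE; apply: (subsetP (ball2S3 e _ _)).
by apply: (subsetP (ball1S2 e _)); rewrite ?ball1_refl ?set11.
Qed.

Section Coarsening.

Variables P Q : {set {set T}}.
Hypotheses (P_part : partition P [set: T]) (Q_part : partition Q [set: T]).
Hypothesis PQ : refines P Q.

(** Homogeneity passes to subsets, so coarsening never destroys adjacency and distances between
    parts can only shrink. Hence runs only grow. *)
Lemma refines_ball1 x y : pblock P y \in ball1 e P (pblock P x) ->
  pblock Q y \in ball1 e Q (pblock Q x).
Proof.
have [_ yQ] := partition_pblock y Q_part.
rewrite !inE yQ => /andP[_ /orP[/eqP yx|]].
  by rewrite (refines_pblock_eq P_part Q_part PQ yx) eqxx.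
by move=> xy; apply/orP; right; apply: contraNN xy; apply: homogeneousS.
Qed.

Lemma refines_ball3 x y : pblock P y \in ball3 e P (pblock P x) ->
  pblock Q y \in ball3 e Q (pblock Q x).
Proof.
case/bigcupP=> V /bigcupP[U xU UV] Vy.
have [u uE] := partition_neq0 P_part (ball1P xU).
have [v vE] := partition_neq0 P_part (ball1P UV).
subst U V; apply/bigcupP; exists (pblock Q v); last exact: refines_ball1.
by apply/bigcupP; exists (pblock Q u); apply: refines_ball1.
Qed.

Lemma refines_run : refines (run_partition P) (run_partition Q).
Proof.
move=> x; apply/subsetP=> y; rewrite !mem_run_partition //.
case/andP=> /eqP xy /forallP far; apply/andP; split.
  by apply/eqP; apply: refines_pblock_eq xy.
apply/forallP=> z; apply/implyP => /(implyP (far z)); exact: refines_ball3.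
Qed.

End Coarsening.

(** The run of [a] cannot extend past [b], whose part is far, so [x] precedes [b]. Likewise the run
    of [b] cannot extend back past [x]. *)
Lemma run_separated P a b x y : partition P [set: T] ->
  pblock P b \notin ball3 e P (pblock P a) ->
  run e S P a x -> run e S P b y -> bst_order S a b -> bst_order S x y.
Proof.
move=> pP far /andP[/eqP ax /forallP aP] /andP[/eqP bby /forallP bP] ab.
have far' : pblock P x \notin ball3 e P (pblock P b).
  rewrite -ax; apply: contra far; apply: ball3_sym.
    by case: (partition_pblock b pP).
  by case: (partition_pblock a pP).
have neq u v : pblock P u \notin ball3 e P (pblock P v) -> u != v.
  apply: contraNneq => ->; have [_ vP] := partition_pblock v pP.
  apply: (subsetP (ball2S3 e _ _)); apply: (subsetP (ball1S2 e vP)).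
  exact: ball1_refl.
have xb : bst_order S x b.
  have /orP[//|bx] := bst_order_total S_bst (neq _ _ far').
  have := implyP (aP b); rewrite /between ab bx => /(_ isT).
  by rewrite (negPf far).
have xy : x != y by apply: neq; rewrite -bby.
have /orP[//|yx] := bst_order_total S_bst xy.
have := implyP (bP x); rewrite /between xb yx orbT => /(_ isT).
by rewrite (negPf far').
Qed.

Lemma run_homogeneous P A B a b : partition P [set: T] ->
    {in A, forall x, run e S P a x} -> {in B, forall y, run e S P b y} ->
    pblock P b \notin ball3 e P (pblock P a) ->
  homogeneous [:: e; bst_order S] A B.
Proof.
move=> pP aA bB far.
have [_ aP] := partition_pblock a pP; have [_ bP] := partition_pblock b pP.
have far' : pblock P a \notin ball3 e P (pblock P b).
  by apply: contra far; apply: ball3_sym.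
have hom_e : homogeneous [:: e] (pblock P a) (pblock P b).
  apply: contraNT far => nhom; apply: (subsetP (ball2S3 e _ _)).
  by apply: (subsetP (ball1S2 e aP)); rewrite inE bP nhom orbT.
have sub u (V : {set T}) :
    {in V, forall x, run e S P u x} -> V \subset pblock P u.
  move=> uV; apply/subsetP=> v /uV /andP[uv _].
  by rewrite -partition_eq_pblock.
have := homogeneousS (sub a A aA) (sub b B bB) hom_e.
rewrite /= !andbT => ->; rewrite /= /uniform.
have neq : a != b.
  apply: contraNneq far => ->; apply: (subsetP (ball2S3 e _ _)).
  by apply: (subsetP (ball1S2 e bP)); apply: ball1_refl.
have /orP[ab|ba] := bst_order_total S_bst neq.
  have AB x y : x \in A -> y \in B -> bst_order S x y.
    by move=> /aA ax /bB by'; apply: run_separated far ax by' ab.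
  apply/andP; split; apply/orP; [left|right].
    by apply/forall_inP=> x xA; apply/forall_inP=> y yB; apply: AB.
  apply/forall_inP=> y yB; apply/forall_inP=> x xA.
  by rewrite (bst_order_asym (AB x y xA yB)).
have BA x y : x \in A -> y \in B -> bst_order S y x.
  by move=> /aA ax /bB by'; apply: run_separated far' by' ax ba.
apply/andP; split; apply/orP; [right|left].
  apply/forall_inP=> x xA; apply/forall_inP=> y yB.
  by rewrite (bst_order_asym (BA x y xA yB)).
by apply/forall_inP=> y yB; apply/forall_inP=> x xA; apply: BA.
Qed.

Definition run_bound K := (2 ^ (K * K) * K.*2.+2).+1.
Definition width_bound K := (2 + K * K * K) * run_bound K.

(** * Red degrees between two consecutive run partitions *)

Section MergeStep.

Variables (P Q : {set {set T}}) (K : nat).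
Hypotheses (P_part : partition P [set: T]) (Q_part : partition Q [set: T]).
Hypothesis P_deg : {in P, forall X, #|ball1 e P X| <= K}.
Hypothesis Q_deg : {in Q, forall X, #|ball1 e Q X| <= K}.
Hypothesis PQ_merges : merges P Q.

Lemma merges_refines : refines P Q.
Proof.
case/exists_inP: PQ_merges => X XP /exists_inP[Y YP /andP[XY /eqP->]].
exact: refines_merge.
Qed.

(** Choose a vertex in each part of [R] that is not homogeneous to [A]. These vertices lie in
    distinct runs of [P], so [run_count] bounds their number in each part of [P], and it remains to
    bound the number of parts of [P] they meet. *)
Lemma intermediate_degree R A : partition R [set: T] ->
    refines (run_partition P) R -> refines R (run_partition Q) -> A \in R ->
  red_degree [:: e; bst_order S] R A <= width_bound K.
Proof.
move=> pR PR RQ AR; have [a AE] := partition_neq0 pR AR.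
rewrite /red_degree; set Bs := [set Y in _ | _].
have /fin_all_exists[f fP] B : exists b, B \in R -> b \in B.
  have [/(partition_neq0 pR)[b ->]|_] := boolP (B \in R); last by exists a.
  by exists b; case: (partition_pblock b pR).
have BsR B : B \in Bs -> B \in R by rewrite !inE => /andP[/andP[]].
have fK B : B \in Bs -> pblock R (f B) = B.
  by move=> /BsR BR; apply: partition_def_pblock (fP B BR).
have <- : #|f @: Bs| = #|Bs|.
  by apply: card_in_imset => B C /fK {2}<- /fK {2}<- ->.
have runQ u v : v \in pblock R u -> run e S Q u v.
  by move/(subsetP (RQ u)); rewrite mem_run_partition.
(* [A] and [B] lie inside runs of [Q], and runs from far parts are homogeneous. *)
have near B : B \in Bs -> pblock Q (f B) \in ball3 e Q (pblock Q a).
  move=> BBs; have BR := BsR B BBs.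
  move: (BBs); rewrite inE => /andP[_]; apply: contraNT => far.
  apply: (run_homogeneous Q_part _ _ far) => x; first by rewrite AE => /runQ.
  by rewrite -{1}(fK B BBs) => /runQ.
case/exists_inP: PQ_merges => X XP /exists_inP[Y YP /andP[XY /eqP QE]].
pose M Z := [set m in f @: Bs | pblock P m == Z].
(* A part of [P] is one of the two merged parts or is still a part of [Q]; this gives the factor
   [2 + K * K * K]. *)
pose I := [set X; Y] :|: ball3 e Q (pblock Q a).
have sub : f @: Bs \subset \bigcup_(Z in I) M Z.
  apply/subsetP=> m mBs; have [mp mP] := partition_pblock m P_part.
  apply/bigcupP; exists (pblock P m); last by rewrite inE mBs eqxx.
  rewrite in_setU; have [//|mXY] := boolP (pblock P m \in [set X; Y]).
  have mQ : pblock P m \in Q by rewrite QE in_setU1 in_setD mXY mP orbT.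
  rewrite -(partition_def_pblock Q_part mQ mp).
  by case/imsetP: mBs => B BBs ->; apply: near.
apply: leq_trans (subset_leq_card sub) _; apply: card_bigcup_le => [|Z _].
  apply: leq_trans (leq_card_setU _ _) _; rewrite cards2 XY leq_add //.
  by apply: card_ball3 => //; case: (partition_pblock a Q_part).
apply: (run_count e_tournament S_bst P_part P_deg (X0 := Z)) => [m|m m'].
  by rewrite inE => /andP[_ /eqP].
rewrite !in_set => /andP[/imsetP[B BBs ->] _] /andP[/imsetP[C CBs ->] _].
rewrite -mem_run_partition // => /(subsetP (PR _)).
rewrite (fK B BBs) => fC.
by rewrite -{1}(partition_def_pblock pR (BsR B BBs) fC) (fK C CBs).
Qed.

Lemma contracts_run_partition :
  contracts [:: e; bst_order S] (width_bound K) (run_partition P) (run_partition Q).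
Proof.
apply: refines_contracts; try exact: run_partitionP.
  by apply: refines_run => //; apply: merges_refines.
by move=> R A pR PR RQ AR; apply: intermediate_degree.
Qed.

End MergeStep.

End RunPartition.

(** * Assembling the contraction sequence *)

Theorem lemma1p4 :
  exists f : nat -> nat,
    forall (T : finType) (e : rel T) (S : bintree T),
      tournament e -> bst e S ->
      tww [:: e; bst_order S] <= f (tww [:: e]).
Proof.
(* [ball1] contains its centre, so its size is bounded by the red degree plus one. *)
exists (fun d => width_bound d.+1) => T e S e_tournament S_bst.
have [T0|T0] := posnP #|T|.
  apply: (@leq_trans #|T|); last by rewrite T0.
  rewrite /tww; apply: (big_ind (fun m => m <= #|T|)) => //.
    by move=> m n mT nT; rewrite geq_min mT.
  by move=> s; apply: width_le.
have [s cs ws] := tww_attained [:: e] T0; set d := tww _ in ws *.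
case/and4P: cs => /allP ps /eqP hs /eqP ls ms.
have sd P : P \in tval s -> {in P, forall X, #|ball1 e P X| <= d.+1}.
  move=> Ps X XP; apply: leq_trans (card_ball1 e XP) _; rewrite ltnS -ws.
  apply: leq_trans (leq_bigmax_seq _ Ps isT); exact: leq_bigmax_cond.
have contr l P : path (@merges T) P l -> {subset P :: l <= tval s} ->
    contracts [:: e; bst_order S] (width_bound d.+1)
      (run_partition e S P) (run_partition e S (last P l)).
  elim: l P => [|Q l IHl] P /=; first by move=> _ _; apply: contracts_refl.
  case/andP=> PQ Ql sub; have PQs : {subset Q :: l <= tval s}.
    by move=> R Rl; apply: sub; rewrite inE Rl orbT.
  have [Ps Qs] : P \in tval s /\ Q \in tval s.
    by split; [apply: sub|apply: PQs]; apply: mem_head.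
  apply: (@contracts_trans _ _ _ (run_partition e S Q)); last exact: IHl.
  by apply: contracts_run_partition; rewrite ?ps //; apply: sd.
apply: tww_contracts => //; case: (tval s) hs ls ms ps contr => [|P l] /= hs ls.
  have [x _] := card_gt0P T0.
  have : [set x] \in [set [set y] | y : T] by apply: imset_f.
  by rewrite -hs inE.
move=> Pl ps /(_ l P Pl (fun _ => id)); rewrite hs.
(* The two end partitions are their own run partitions, so the chain runs from the singletons to the
   single part. *)
rewrite run_partition_singletons // -hs ls run_partition_full //.
by rewrite -ls ps // mem_last.
Qed.
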